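(* Assume that: (1) $\mathscr{H}$ is separable; (2) the canonical feature map $\varphi : E\to\mathscr{H}$ is Borel measurable; (3) $\mathbb{E}[\|\varphi(X)\|_{\mathscr{H}}^2]<\infty$ and $\mathbb{E}[\|\varphi(Y)\|_{\mathscr{H}}^2]<\infty$; (4) $\mathscr{H}\subseteq C_0(E)$; (5) $\mathscr{H}$ is dense in $L^2(\pi)$. Then there exists a sequence $(A_n)_{n\in\mathbb{N}}$ of finite-rank operators from $\mathscr{H}$ to $\mathscr{H}$ such that $$\|A_n-P\|_{\mathscr{H}\to L^2(\pi)}\to 0\quad\text{as } n\to\infty .$$
   Context: Let $E$ be a second countable locally compact Hausdorff space with Borel $\sigma$-field $\mathcal{F}_E$, and let $X,Y$ be $E$-valued random variables on a common probability space $(\Omega,\mathcal{F},\mathbb{P})$ with laws $X\sim\pi$ and $Y\sim\nu$. Let $p:E\times\mathcal{F}_E\to[0,1]$ be a Markov kernel that is a regular version of the conditional distribution of $Y$ given $X$, i.e. $\mathbb{P}[X\in\mathcal{A},Y\in\mathcal{B}]=\int_{\mathcal{A}}p(x,\mathcal{B})\,d\pi(x)$ for all $\mathcal{A},\mathcal{B}\in\mathcal{F}_E$. Write $L^2(\pi)=L^2(E,\mathcal{F}_E,\pi;\mathbb{R})$. The conditional expectation operator is $P:L^2(\nu)\to L^2(\pi)$, $[Pf](x)=\mathbb{E}[f(Y)\mid X=x]=\int_E f(y)\,p(x,dy)$. $\mathscr{H}$ is the real reproducing kernel Hilbert space of functions $E\to\mathbb{R}$ with kernel $k:E\times E\to\mathbb{R}$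 and canonical feature map $\varphi(x)=k(x,\cdot)$. $C_0(E)$ is the space of continuous real-valued functions on $E$ vanishing at infinity. Under (1)--(3), the inclusions $i_\pi:\mathscr{H}\to L^2(\pi)$ and $i_\nu:\mathscr{H}\to L^2(\nu)$, sending $f$ to its a.e.-equivalence class, are bounded; ''dense in $L^2(\pi)$'' means that the range of $i_\pi$ is dense. For bounded $A:\mathscr{H}\to\mathscr{H}$, the quantity $\|A-P\|_{\mathscr{H}\to L^2(\pi)}$ denotes the operator norm of $i_\pi A-P\,i_\nu:\mathscr{H}\to L^2(\pi)$. Finite-rank operators are bounded linear operators with finite-dimensional range. *)

(* Defs.v *)
From HB Require Import structures.
From mathcomp Require Import all_boot all_order all_algebra.
From mathcomp Require Import all_classical all_reals all_analysis.

Set Implicit Arguments.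
Unset Strict Implicit.
Unset Printing Implicit Defensive.
Import Order.TTheory GRing.Theory Num.Theory.
Import numFieldNormedType.Exports.

Local Open Scope classical_set_scope.
Local Open Scope ring_scope.

Notation borel E := (g_sigma_algebraType (@open E)).

(* A reproducing kernel Hilbert space on [E] with kernel [k].  The carrier is
   an abstract Hilbert space whose elements are identified with functions
   [E -> R] through the injective linear map [rkhs_eval]. *)
Record rkhs (R : realType) (E : Type) (k : E -> E -> R) := Rkhs {
  rkhs_space :> completeNormedModType R ;
  rkhs_inner : {dot rkhs_space for idfun} ;
  rkhs_innerE : forall f, rkhs_inner f f = `|f| ^+ 2 ;
  rkhs_eval : {linear rkhs_space -> (E -> R)} ;
  rkhs_eval_inj : injective rkhs_eval ;
  rkhs_feature : E -> rkhs_space ;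
  rkhs_featureE : forall x, rkhs_eval (rkhs_feature x) = k x ;
  rkhs_reproducing : forall f x,
    rkhs_eval f x = rkhs_inner f (rkhs_feature x)
}.

Definition separable_space (T : topologicalType) :=
  exists2 D : set T, countable D & dense D.

Definition C0 (R : realType) (E : topologicalType) : set (E -> R) :=
  [set f | continuous f /\
    forall e : R, 0 < e ->
      exists2 K : set E, compact K & forall x, ~ K x -> `|f x| < e].

(* Elements of L^2(mu) are handled through their representatives: square
   integrable measurable functions ([Lfun mu 2]) with the seminorm
   ['N[mu]_2], so that a.e. equal functions are at distance 0. *)
Definition dense_in_L2 (d : measure_display) (T : measurableType d)
    (R : realType) (mu : {measure set T -> \bar R}) (F : set (T -> R)) :=
  forall g : T -> R, g \in Lfun mu 2%:E -> forall e : R, 0 < e ->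
    exists2 f, F f & ('N[mu]_2[EFin \o (f \- g)%R] < e%:E)%E.

Definition regular_cond_distribution (d d' d'' : measure_display)
    (Omega : measurableType d) (S : measurableType d') (T : measurableType d'')
    (R : realType) (P : probability Omega R)
    (X : {RV P >-> S}) (Y : {RV P >-> T}) (p : R.-pker S ~> T) :=
  forall (A : set S) (B : set T), measurable A -> measurable B ->
    P (X @^-1` A `&` Y @^-1` B) = (\int[distribution P X]_(x in A) p x B)%E.

Definition cond_expectation (d d' : measure_display)
    (S : measurableType d) (T : measurableType d') (R : realType)
    (p : R.-pker S ~> T) (f : T -> R) : S -> R :=
  fun x => \int[p x]_y f y.

Definition finite_rank (R : realType) (V : normedModType R)
    (A : {linear V -> V}) :=
  (exists C : R, forall f, `|A f| <= C * `|f|) /\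
  exists (n : nat) (e : 'I_n -> V), forall f,
    exists c : 'I_n -> R, A f = \sum_(i < n) c i *: e i.

(* The operator norm of [i_mu A - P i_nu : H -> L^2(mu)], where [P] is the
   conditional expectation operator of the kernel [p]; the inclusions into
   L^2 are [rkhs_eval H], elements of L^2 being represented by functions. *)
Definition opnorm_sub (R : realType) (E : ptopologicalType)
    (k : E -> E -> R) (H : rkhs k) (mu : {measure set (borel E) -> \bar R})
    (p : R.-pker (borel E) ~> (borel E)) (A : H -> H) : \bar R :=
  ereal_sup [set ('N[mu]_2[EFin \o (rkhs_eval H (A f) \-
                              cond_expectation p (rkhs_eval H f))%R])%E
            | f in [set f : H | `|f| <= 1]].

(* Main.v *)
Require Import Defs.
From HB Require Import structures.
From mathcomp Require Import all_boot all_order all_algebra.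
From mathcomp Require Import all_classical all_reals all_analysis.
From mathcomp Require Import measurable_realfun ring lra.

Set Implicit Arguments.
Unset Strict Implicit.
Unset Printing Implicit Defensive.
Import Order.TTheory GRing.Theory Num.Theory.
Import numFieldNormedType.Exports.

Local Open Scope classical_set_scope.
Local Open Scope ring_scope.

(** The operator [P i_nu] is Hilbert-Schmidt, which by itself gives finite-rank
    approximations with values in L^2(pi); density of the RKHS then moves their
    range into the RKHS.  Both steps can be made explicit without orthonormal
    bases, because the reproducing property [f y = <f, phi y>] turns an
    approximation of the feature map into one of the operator.

    Since the RKHS is separable and [phi] is square integrable for [nu], there
    is a simple function [s = \sum_i \1_(B i) *: h i] close to [phi] in
    L^2(nu; H) ([bochner_simple_approx]).  Replacing [phi] by [s] in
    [P f x = \int <f, phi y> p(x, dy)] gives [\sum_i <f, h i> p(x, B i)].  By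
    Cauchy-Schwarz in the RKHS the pointwise error is at most
    [|f| \int |phi y - s y| p(x, dy)]
    ([cond_expectation_sub_simple_le]), and the L^2(pi)-norm of that integral is
    at most the L^2(nu)-norm of [|phi - s|], by Jensen's inequality for
    [p(x, .)] and because [nu] is the mixture of the [p(x, .)] under [pi]
    ([Lnorm2_kernel_integral_le]).

    Each [p(., B i)] is bounded, hence in L^2(pi), hence close to some [g i] in
    the RKHS.  The operator [f |-> \sum_i <f, h i> g i] is bounded, has finite
    rank, and is within [\sum_i |h i| |g i - p(., B i)| + |phi - s|] of [P]
    ([opnorm_sub_finite_rank_op_le]).

    The inclusion in C_0 makes the elements of the RKHS measurable and bounded.
    By boundedness the integrals defining [P f] are finite at every point [x],
    so the pointwise error bound holds without an exceptional null set. *)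

(** * Borel measurability, boundedness, density *)

Lemma continuous_borel_measurable (R : realType) (T : ptopologicalType)
    (f : T -> R) :
  continuous f -> measurable_fun [set: borel T] (f : borel T -> R).
Proof.
move=> /continuousP cf.
apply: (measurability _ (@measurable_realfun.RGenInftyO.measurableE R)).
move=> _ [_ [x ->] <-]; rewrite setTI.
by apply: sub_sigma_algebra; apply: cf; exact: interval_open.
Qed.

Lemma separable_dense_seq (R : realType) (V : normedModType R) :
  separable_space V -> exists h : nat -> V,
  forall (v : V) (e : R), 0 < e -> exists i, `|v - h i| < e.
Proof.
move=> [D cD dD].
have dball (v : V) (e : R) : 0 < e -> exists2 w, D w & `|v - w| < e.
  move=> e0; have [||w [vw Dw]] := dD (ball v e).
  - by exists v; exact: ballxx.
  - exact: ball_open.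
  - by exists w => //; rewrite -ball_normE in vw.
have /pfcard_geP[D0|[h]] := cD.
  by have [w] := dball 0 1 ltr01; rewrite D0.
exists h => v e /(dball v) [w Dw vw].
by have [i _ hi] := @surj _ _ _ _ h _ Dw; exists i; rewrite hi.
Qed.

(** [f] is below 1 in absolute value off a compact set, whose image under [f]
    is compact. *)
Lemma C0_bounded (R : realType) (T : ptopologicalType) (f : T -> R) :
  C0 f -> exists M, forall x, `|f x| <= M.
Proof.
move=> [cf /(_ 1 ltr01)[K cK fK]].
have /compact_bounded[M [Mreal fM]] : compact (f @` K).
  by apply: continuous_compact => //; exact: continuous_subspaceT.
exists (Num.max 1 (M + 1)) => x; rewrite le_max.
have [Kx|nKx] := pselect (K x); last by rewrite ltW// fK.
by apply/orP; right; apply: (fM (M + 1)); [rewrite ltrDl|exists x].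
Qed.

(** * Finite-rank operators on a reproducing kernel Hilbert space *)

Section rkhs_theory.
Context (R : realType) (E : Type) (k : E -> E -> R) (H : rkhs k).

Lemma rkhs_innerC f g : rkhs_inner H f g = rkhs_inner H g f.
Proof. by rewrite (hermC (rkhs_inner H)) expr0 mul1r. Qed.

Lemma rkhs_CauchySchwarz f g : `|rkhs_inner H f g| <= `|f| * `|g|.
Proof.
set c := rkhs_inner H f g.
have main (a b : R) :
    0 <= a ^+ 2 * `|f| ^+ 2 - (a * b * c) *+ 2 + b ^+ 2 * `|g| ^+ 2.
  rewrite -!rkhs_innerE.
  suff <- : rkhs_inner H (a *: f - b *: g) (a *: f - b *: g) =
      a ^+ 2 * rkhs_inner H f f - (a * b * c) *+ 2 + b ^+ 2 * rkhs_inner H g g.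
    by rewrite rkhs_innerE exprn_ge0.
  rewrite linearBr !linearBl !linearZl !linearZr/= [rkhs_inner H g f]rkhs_innerC.
  rewrite -/c /GRing.scale/=.
  move: (rkhs_inner H f f) (rkhs_inner H g g) => u v; ring.
(* Dividing by [2 |f| |g|] below requires both norms to be nonzero. *)
have [f0|f0] := eqVneq `|f| 0.
  by rewrite /c (normr0_eq0 f0) linear0l !normr0 mul0r.
have [g0|g0] := eqVneq `|g| 0.
  by rewrite /c (normr0_eq0 g0) linear0r !normr0 mulr0.
have f_gt0 : 0 < `|f| by rewrite lt_def f0 /=.
have g_gt0 : 0 < `|g| by rewrite lt_def g0 /=.
have fg_gt0 : 0 < `|f| * `|g| *+ 2 by rewrite pmulrn_lgt0 // mulr_gt0.
(* At these coefficients, which equalize the two square terms, the form factors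
   as [2 |f| |g| (|f| |g| -+ c)]. *)
have := main `|g| `|f|; have := main (- `|g|) `|f|.
move: (`|f|) (`|g|) fg_gt0 => u v uv0 h1 h2.
have h1' : 0 <= (u * v *+ 2) * (u * v + c) by apply: (le_trans h1); lra.
have h2' : 0 <= (u * v *+ 2) * (u * v - c) by apply: (le_trans h2); lra.
rewrite pmulr_rge0 // in h1'; rewrite pmulr_rge0 // in h2'.
by rewrite ler_norml; apply/andP; split; lra.
Qed.

Definition finite_rank_op (N : nat) (h g : 'I_N -> H) (f : H) : H :=
  \sum_(i < N) rkhs_inner H f (h i) *: g i.

Lemma finite_rank_op_is_linear N (h g : 'I_N -> H) :
  linear (finite_rank_op h g).
Proof.
move=> a u v; rewrite /finite_rank_op scaler_sumr -big_split/=.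
by apply: eq_bigr => i _; rewrite linearPl/= scalerDl scalerA.
Qed.

HB.instance Definition _ N (h g : 'I_N -> H) :=
  @GRing.isLinear.Build R H H _ (finite_rank_op h g)
    (finite_rank_op_is_linear h g).

Lemma finite_rank_opP N (h g : 'I_N -> H) : finite_rank (finite_rank_op h g).
Proof.
split.
  exists (\sum_(i < N) `|h i| * `|g i|) => f.
  rewrite mulr_suml (le_trans (ler_norm_sum _ _ _))//.
  apply: ler_sum => i _; rewrite normrZ mulrAC ler_wpM2r// mulrC.
  exact: rkhs_CauchySchwarz.
by exists N, g => f; exists (fun i => rkhs_inner H f (h i)).
Qed.

Lemma rkhs_eval_finite_rank_op N (h g : 'I_N -> H) f x :
  rkhs_eval H (finite_rank_op h g f) x =
  \sum_(i < N) rkhs_inner H f (h i) * rkhs_eval H (g i) x.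
Proof.
rewrite /finite_rank_op linear_sum fct_sumE.
by apply: eq_bigr => i _; rewrite linearZ.
Qed.

End rkhs_theory.

(** * Lp seminorms *)

Section Lnorm_extra.
Local Open Scope ereal_scope.

Lemma measurable_abse_poweR d (T : measurableType d) (R : realType) (r : R)
    (h : T -> \bar R) :
  measurable_fun [set: T] h -> measurable_fun [set: T] (fun x => `|h x| `^ r).
Proof.
move=> mh; apply: (@measurableT_comp _ _ _ _ _ _ (@poweR R ^~ r)).
  exact: measurable_poweR.
exact: measurableT_comp.
Qed.

Lemma le_Lnorm d (T : measurableType d) (R : realType)
    (mu : {measure set T -> \bar R}) (r : R) (f g : T -> \bar R) :
  (0 <= r)%R -> measurable_fun [set: T] f -> measurable_fun [set: T] g ->
  (forall x, `|f x| <= `|g x|) -> 'N[mu]_r%:E[f] <= 'N[mu]_r%:E[g].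
Proof.
move=> r0 mf mg fg.
have pos (h : T -> \bar R) : 0 <= \int[mu]_x (`|h x| `^ r).
  by apply: integral_ge0 => x _; exact: poweR_ge0.
rewrite unlock; apply: gt0_ler_poweR.
- by rewrite invr_ge0.
- by rewrite in_itv/= leey pos.
- by rewrite in_itv/= leey pos.
apply: ge0_le_integral => //.
- by move=> x _; exact: poweR_ge0.
- exact: measurable_abse_poweR.
- exact: measurable_abse_poweR.
- by move=> x _; apply: gt0_ler_poweR => //; rewrite in_itv/= leey abse_ge0.
Qed.

(** Hoelder's inequality against the constant 1, which has norm 1 for a measure
    of total mass 1. *)
Lemma Lnorm1_le_Lnorm2 d (T : measurableType d) (R : realType)
    (mu : {measure set T -> \bar R}) (g : T -> R) :
  mu [set: T] = 1 ->
  measurable_fun [set: T] g -> 'N[mu]_1[EFin \o g] <= 'N[mu]_2%:E[EFin \o g].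
Proof.
move=> mu1 mg.
have half2 : (2^-1 + 2^-1 = 1 :> R)%R by lra.
have := hoelder mu mg (@measurable_cst _ _ T R setT 1%R) (ltr0n _ 2)
  (ltr0n _ 2) half2.
rewrite (_ : EFin \o cst 1%R = cst 1); last by [].
rewrite Lnorm_cst1 mu1 poweR1r mule1.
by congr (_ <= _); apply: eq_Lnorm => x /=; rewrite mulr1.
Qed.

End Lnorm_extra.

Section Lnorm_linear.
Local Open Scope ereal_scope.
Context d (T : measurableType d) (R : realType).
Context (mu : {measure set T -> \bar R}).

(** The scalar is pulled out of the integral of a nonnegative function, so the
    identity also covers [f] of infinite norm. *)
Lemma Lnorm_scale (r a : R) (f : T -> R) : (0 < r)%R ->
  measurable_fun [set: T] f ->
  'N[mu]_r%:E[EFin \o (a \*o f)%R] = `|a|%:E * 'N[mu]_r%:E[EFin \o f].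
Proof.
move=> r0 mf; rewrite unlock.
under eq_integral => x _ do rewrite [`|_|]/= normrM EFinM poweRM ?lee_fin//.
rewrite ge0_integralZl//; last 3 first.
- apply: (@measurable_abse_poweR _ _ _ _ (EFin \o f)).
  exact/measurable_EFinP.
- by move=> x _; exact: poweR_ge0.
- exact: poweR_ge0.
rewrite poweRM; last 2 first.
- exact: poweR_ge0.
- by apply: integral_ge0 => x _; exact: poweR_ge0.
by rewrite -poweRrM divff ?gt_eqF// poweRe1// abse_ge0.
Qed.

Lemma Lnorm_sum_le (r : R) N (a : nat -> R) (f : nat -> T -> R) : (1 <= r)%R ->
  (forall i, measurable_fun [set: T] (f i)) ->
  'N[mu]_r%:E[EFin \o (fun x => \sum_(i < N) a i * f i x)%R] <=
  \sum_(i < N) `|a i|%:E * 'N[mu]_r%:E[EFin \o f i].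
Proof.
move=> r1 mf; have r0 : (0 < r)%R := lt_le_trans ltr01 r1.
elim: N => [|N ih].
  rewrite big_ord0 (@eq_Lnorm _ _ _ _ _ _ (cst 0)) ?Lnorm0 ?gt_eqF ?lte_fin//.
  by move=> x /=; rewrite big_ord0.
rewrite big_ord_recr/= -Lnorm_scale//.
apply: le_trans (leeD2r _ ih).
have maf i : measurable_fun [set: T] (a i \*o f i)%R.
  by apply: measurable_funM => //; exact: measurable_cst.
rewrite [leLHS](@eq_Lnorm _ _ _ _ _ _ (EFin \o
    ((fun x => \sum_(i < N) a i * f i x) \+ (a N \*o f N))%R)).
  by apply: minkowski_EFin => //; apply: measurable_sum => i; exact: maf.
by move=> x /=; rewrite big_ord_recr.
Qed.

End Lnorm_linear.

(** * Integrals against a probability kernel *)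

Lemma regular_cond_distribution_marginal (d d' d'' : measure_display)
    (Omega : measurableType d) (S : measurableType d') (T : measurableType d'')
    (R : realType) (P : probability Omega R)
    (X : {RV P >-> S}) (Y : {RV P >-> T}) (p : R.-pker S ~> T) :
  regular_cond_distribution X Y p -> forall B, measurable B ->
  distribution P Y B = (\int[distribution P X]_x p x B)%E.
Proof.
by move=> pXY B mB; rewrite -(pXY setT B measurableT mB) preimage_setT setTI.
Qed.

(** The hypothesis on [nu] says that it is the composition of [pi] with [p], so
    this is the integration rule for composed kernels. *)
Lemma integral_disintegration d d' (S : measurableType d)
    (T : measurableType d')
    (R : realType) (pi : probability S R) (nu : {measure set T -> \bar R})
    (p : R.-pker S ~> T) (f : T -> \bar R) :
  (forall B, measurable B -> nu B = (\int[pi]_x p x B)%E) ->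
  (forall y, 0 <= f y)%E -> measurable_fun [set: T] f ->
  (\int[nu]_y f y = \int[pi]_x \int[p x]_y f y)%E.
Proof.
move=> nuE f0 mf.
(* Kernel composition takes a kernel as first factor and a second factor that
   also sees the initial state: [pi] becomes a kernel from [unit], and [p] is
   extended to ignore the [unit] component. *)
have mpi : measurable_fun [set: unit] (fun=> pi : pprobability S R).
  exact: measurable_cst.
pose l : R.-sfker unit ~> S := kprobability mpi.
pose q : R.-sfker (unit * S) ~> T := @kernel.kernel_snd _ _ _ unit S T R p.
rewrite -(integral_kcomp l q tt f0 mf).
by apply: eq_measure_integral => B mB _; exact: nuE.
Qed.

Section kernel_contraction.
Local Open Scope ereal_scope.

(** The conditional expectation operator contracts L^2(nu) into L^2(pi):
    Jensen's inequality at each [x], then integration over [pi].  The extended-valued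
    integral on the left is allowed to be infinite at some [x]. *)
Lemma Lnorm2_kernel_integral_le d d' (S : measurableType d)
    (T : measurableType d')
    (R : realType) (pi : probability S R) (nu : {measure set T -> \bar R})
    (p : R.-pker S ~> T) (g : T -> R) :
  (forall B, measurable B -> nu B = \int[pi]_x (p x B)) ->
  measurable_fun [set: T] g -> (forall y, (0 <= g y)%R) ->
  'N[pi]_2%:E[(fun x => \int[p x]_y (g y)%:E)] <= 'N[nu]_2%:E[EFin \o g].
Proof.
move=> nuE mg g0.
have mEg : measurable_fun [set: T] (EFin \o g) by exact/measurable_EFinP.
have int_ge0 x : 0 <= \int[p x]_y (g y)%:E.
  by apply: integral_ge0 => y _; rewrite lee_fin.
have mint : measurable_fun [set: S] (fun x => \int[p x]_y (g y)%:E).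
  by apply: measurable_fun_integral_kernel => //; exact: measurable_kernel.
rewrite unlock; apply: gt0_ler_poweR.
- by rewrite invr_ge0.
- by rewrite in_itv/= leey integral_ge0// => x _; exact: poweR_ge0.
- by rewrite in_itv/= leey integral_ge0// => x _; exact: poweR_ge0.
rewrite (integral_disintegration nuE) //; last 2 first.
- by move=> y; exact: poweR_ge0.
- exact: measurable_abse_poweR.
apply: ge0_le_integral => //.
- by move=> x _; exact: poweR_ge0.
- exact: measurable_abse_poweR.
- apply: measurable_fun_integral_kernel => //; first exact: measurable_kernel.
    by move=> y; exact: poweR_ge0.
  exact: measurable_abse_poweR.
move=> x _; rewrite -(@poweR_Lnorm _ _ _ (p x)) ?pnatr_eq0//.
apply: gt0_ler_poweR => //.
- by rewrite in_itv/= leey abse_ge0.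
- by rewrite in_itv/= leey Lnorm_ge0.
rewrite gee0_abs//.
have := @Lnorm1_le_Lnorm2 _ _ _ (p x) g (@prob_kernel _ _ _ _ _ p x) mg.
rewrite Lnorm1; under eq_integral do rewrite /= ger0_norm//.
done.
Qed.

End kernel_contraction.

Section finite_measure_integral.
Context d (T : measurableType d) (R : realType).
Context (mu : {measure set T -> \bar R}).
Hypothesis muT : (mu [set: T] < +oo)%E.

Lemma bounded_integrable (f : T -> R) (M : R) : measurable_fun [set: T] f ->
  (forall x, `|f x| <= M) -> mu.-integrable [set: T] (EFin \o f).
Proof.
move=> mf fM; apply: measurable_bounded_integrable => //.
exists M; split; first exact: num_real.
by move=> y My x _; exact: le_trans (fM x) (ltW My).
Qed.

Lemma integrable_simple N (c : nat -> R) (B : nat -> set T) :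
  (forall i, measurable (B i)) ->
  mu.-integrable [set: T] (EFin \o (fun y => \sum_(i < N) c i * \1_(B i) y)).
Proof.
move=> mB; apply: (@bounded_integrable _ (\sum_(i < N) `|c i|)) => [|y].
  by apply: measurable_sum => i; apply: measurable_funM.
rewrite (le_trans (ler_norm_sum _ _ _))//; apply: ler_sum => i _.
by rewrite normrM ler_piMr// indicE; case: (_ \in _); rewrite ?normr1 ?normr0.
Qed.

Lemma Rintegral_simple N (c : nat -> R) (B : nat -> set T) :
  (forall i, measurable (B i)) ->
  \int[mu]_y (\sum_(i < N) c i * \1_(B i) y) =
  \sum_(i < N) c i * fine (mu (B i)).
Proof.
move=> mB; elim: N => [|N ih].
  under eq_Rintegral do rewrite big_ord0.
  by rewrite big_ord0 /Rintegral integral0.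
under eq_Rintegral do rewrite big_ord_recr/=.
have iN : mu.-integrable [set: T] (EFin \o \1_(B N)).
  apply: (@bounded_integrable _ 1) => [//|y].
  by rewrite indicE; case: (_ \in _); rewrite ?normr1 ?normr0.
have icN : mu.-integrable [set: T] (EFin \o (fun y => c N * \1_(B N) y)).
  exact: (integrableZl measurableT (c N) iN).
rewrite RintegralD//; last exact: integrable_simple.
rewrite ih big_ord_recr/= RintegralZl//; congr (_ + _ * _).
by rewrite /Rintegral integral_indic// setIT.
Qed.

End finite_measure_integral.

(** Splitting [f] into positive and negative parts reduces to integrals of
    nonnegative functions, which are measurable in [x]; the extended-real
    difference and [fine] preserve measurability. *)
Lemma measurable_cond_expectation d d' (S : measurableType d)
    (T : measurableType d') (R : realType) (p : R.-pker S ~> T) (f : T -> R) :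
  measurable_fun [set: T] f -> measurable_fun [set: S] (cond_expectation p f).
Proof.
move=> mf; have mEf : measurable_fun [set: T] (EFin \o f).
  exact/measurable_EFinP.
apply: (@measurableT_comp _ _ _ _ _ _ fine) => //.
under eq_fun do rewrite integralE.
by apply: emeasurable_funB; apply: measurable_fun_integral_kernel => //;
  [exact: measurable_kernel|exact: measurable_funepos|
   exact: measurable_kernel|exact: measurable_funeneg].
Qed.

Lemma measurable_fine_kernel d d' (S : measurableType d)
    (T : measurableType d') (R : realType) (p : R.-pker S ~> T) (B : set T) :
  measurable B -> measurable_fun [set: S] (fun x => fine (p x B)).
Proof.
move=> mB; apply: (@measurableT_comp _ _ _ _ _ _ fine) => //.
exact: measurable_kernel.
Qed.

Lemma kernel_Lfun2 d d' (S : measurableType d) (T : measurableType d')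
    (R : realType) (pi : probability S R) (p : R.-pker S ~> T) (B : set T) :
  measurable B -> (fun x => fine (p x B)) \in Lfun pi 2%:E.
Proof.
move=> mB; have mp := measurable_fine_kernel p mB.
rewrite inE/=; apply/andP; split; rewrite inE//= /finite_norm.
apply: (@le_lt_trans _ _ ('N[pi]_2[cst 1])%E).
  apply: le_Lnorm => //; first exact/measurable_EFinP.
  move=> x /=; have pB1 : (p x B <= 1)%E.
    by rewrite -(prob_kernel (s := p) x); apply: le_measure; rewrite ?inE.
  rewrite normr1 ger0_norm ?fine_ge0// fineK// ge0_fin_numE//.
  by rewrite (le_lt_trans pB1)// ltry.
by rewrite Lnorm_cst1 poweR_lty// -ge0_fin_numE// fin_num_measure.
Qed.

(** * Simple approximation of a square-integrable map into a separable space *)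

Section bochner_approximation.
Context d (T : measurableType d) (R : realType) (V : normedModType R).
Variables (u : T -> V) (h : nat -> V).

(** Distance from [u y] to the finite set of 0 and the first [N] points of [h].
    Including 0 keeps it below [|u y|], whose square is the
    dominating function. *)
Fixpoint dist_first (N : nat) (y : T) : R :=
  if N is n.+1 then Num.min (dist_first n y) `|u y - h n| else `|u y|.

Lemma dist_first_ge0 N y : 0 <= dist_first N y.
Proof. by elim: N => //= n ih; rewrite le_min ih/=. Qed.

Lemma dist_first_le_norm N y : dist_first N y <= `|u y|.
Proof. by elim: N => //= n ih; rewrite ge_min ih. Qed.

Lemma dist_first_le N i y : (i < N)%N -> dist_first N y <= `|u y - h i|.
Proof.
elim: N => //= n ih; rewrite ltnS leq_eqVlt => /predU1P[->|/ih le_i].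
  by rewrite ge_min lexx orbT.
by rewrite ge_min le_i.
Qed.

Hypothesis u_meas : measurable_fun [set: T] (u : T -> borel V).

Lemma measurable_normB (v : V) : measurable_fun [set: T] (fun y => `|u y - v|).
Proof.
apply: (@measurableT_comp _ _ _ _ _ _ (fun w : borel V => `|(w : V) - v|))
  => //.
apply: continuous_borel_measurable => w; apply: cvg_norm.
by apply: cvgB; [exact: cvg_id|exact: cvg_cst].
Qed.

Lemma measurable_dist_first N : measurable_fun [set: T] (dist_first N).
Proof.
elim: N => [|n ih] /=.
  by have := measurable_normB 0; under eq_fun do rewrite subr0.
by apply: measurable_minr => //; exact: measurable_normB.
Qed.

(** The nearest-point map onto 0 and the first [N] points of [h] is a simple
    function of [y].  Passing from [N] to [N.+1] redirects to [h N] the points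
    that are strictly closer to it, so ties keep the earlier choice and the
    cells stay disjoint. *)
Lemma dist_first_simple N : exists2 B : nat -> set T,
  (forall i, measurable (B i)) &
  forall y, `|u y - \sum_(i < N) (\1_(B i) y : R) *: h i| = dist_first N y.
Proof.
elim: N => [|N [B mB BE]].
  by exists (fun=> set0) => // y; rewrite big_ord0 subr0.
pose D := [set y | `|u y - h N| < dist_first N y].
have mD : measurable D.
  rewrite -[D]setTI.
  exact: (measurable_fun_ltr (measurable_normB _) (measurable_dist_first N)).
exists (fun i => if i == N then D else B i `\` D) => [i|y].
  by case: ifP => // _; exact: measurableD.
rewrite big_ord_recr/= eqxx.
under eq_bigr => i _ do rewrite ltn_eqF ?ltn_ord//.
have [Dy|nDy] := pselect (D y).
  rewrite big1 ?add0r => [|i _]; last first.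
    by rewrite indicE memNset ?scale0r// => -[].
  by rewrite indicE mem_set// scale1r min_r// ltW.
rewrite [X in _ + X *: _]indicE memNset// scale0r addr0 min_l; last first.
  by rewrite leNgt; exact/negP.
rewrite -BE; congr `| _ - _ |; apply: eq_bigr => i _; congr (_ *: _).
rewrite !indicE; congr ((nat_of_bool _)%:R); apply/idP/idP => /[!inE].
  by case.
by split.
Qed.

Hypothesis h_dense : forall (v : V) (e : R), 0 < e ->
  exists i, `|v - h i| < e.

Lemma dist_first_cvg0 y : dist_first N y @[N --> \oo] --> (0 : R).
Proof.
apply/cvgrPdist_lt => e e0; have [i ui] := h_dense (u y) e0.
exists i.+1 => // N /= iN; rewrite sub0r normrN ger0_norm ?dist_first_ge0//.
exact: le_lt_trans (dist_first_le _ iN) ui.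
Qed.

(** Dominated convergence applies to the squared distances: they tend to 0 by
    density and are bounded by [|u y| ^+ 2]. *)
Lemma bochner_simple_approx (nu : {measure set T -> \bar R}) (e : R) :
  0 < e -> (\int[nu]_y (`|u y| ^+ 2)%:E < +oo)%E ->
  exists N, exists B : nat -> set T, [/\ forall i, measurable (B i),
    measurable_fun [set: T]
      (fun y => `|u y - \sum_(i < N) (\1_(B i) y : R) *: h i|) &
    ('N[nu]_2%:E[EFin \o (fun y =>
      `|u y - \sum_(i < N) (\1_(B i) y : R) *: h i|)%R] < e%:E)%E].
Proof.
move=> e0 u2.
have m2 N : measurable_fun [set: T] (fun y => (dist_first N y ^+ 2)%:E).
  apply/measurable_EFinP; apply: measurable_funX.
  exact: measurable_dist_first.
have [|||_ _] := @dominated_convergence _ T R nu setT measurableT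
  (fun N y => (dist_first N y ^+ 2)%:E) (cst 0%E) (fun y => (`|u y| ^+ 2)%:E)
  m2 (measurable_cst _).
- apply/nearW => y _; apply: cvg_EFin; first exact: nearW.
  rewrite /= -(mulr0 (0 : R)); under eq_fun do rewrite expr2.
  by apply: cvgM; exact: dist_first_cvg0.
- apply/integrableP; split; first exact: (m2 0%N).
  by under eq_integral do rewrite /= ger0_norm ?exprn_ge0//.
- apply/nearW => y N _.
  rewrite /= lee_fin ger0_norm ?exprn_ge0 ?dist_first_ge0//.
  by rewrite lerXn2r ?nnegrE ?dist_first_le_norm//; exact: dist_first_ge0.
rewrite integral0 => dcv.
have /dcv[N _ /(_ N (leqnn _))/= intN] :
    ereal_nbhs 0%E (fun t => (t < (e ^+ 2)%:E)%E).
  by apply: open_ereal_lt'; rewrite lte_fin exprn_gt0.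
have [B mB BE] := dist_first_simple N.
exists N, B.
rewrite (funext BE : (fun y => _) = _).
split=> //; first exact: measurable_dist_first.
rewrite unlock.
under eq_integral => y _.
  rewrite /= ger0_norm ?dist_first_ge0// powR_mulrn ?dist_first_ge0//. over.
rewrite poweR12_sqrt; last first.
  by apply: integral_ge0 => y _ /=; rewrite lee_fin sqr_ge0.
have <- : sqrte (e ^+ 2)%:E = e%:E by rewrite /= sqrtr_sqr gtr0_norm.
rewrite ltNge lee_sqrt -?ltNge//.
by apply: integral_ge0 => y _ /=; rewrite lee_fin sqr_ge0.
Qed.

End bochner_approximation.

(** * Approximating the conditional expectation operator *)

Section main_estimate.
Context (R : realType) (E : ptopologicalType) (k : E -> E -> R) (H : rkhs k).
Context (p : R.-pker (borel E) ~> (borel E)).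
Hypothesis H_sub_C0 : range (rkhs_eval H) `<=` @C0 R E.

Let simple N (h : nat -> H) (B : nat -> set E) (y : E) : H :=
  \sum_(i < N) (\1_(B i) y : R) *: h i.

Lemma measurable_rkhs_eval f :
  measurable_fun [set: borel E] (rkhs_eval H f : borel E -> R).
Proof.
by apply: continuous_borel_measurable; have [] := H_sub_C0 (imageT _ f).
Qed.

Lemma rkhs_eval_sub_simple N (h : nat -> H) (B : nat -> set E) f y :
  rkhs_eval H f y - \sum_(i < N) rkhs_inner H f (h i) * \1_(B i) y =
  rkhs_inner H f (rkhs_feature H y - simple N h B y).
Proof.
rewrite rkhs_reproducing linearBr linear_sumr; congr (_ - _).
by apply: eq_bigr => i _; rewrite linearZr/= mulrC.
Qed.

(** The sum is the integral of [<f, s y>] against [p x], where [s] is the simple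
    function; the difference integrates [<f, phi y - s y>], which Cauchy-Schwarz
    bounds. *)
Lemma cond_expectation_sub_simple_le N (h : nat -> H)
    (B : nat -> set (borel E)) f x :
  (forall i, measurable (B i)) ->
  measurable_fun [set: borel E]
    (fun y : borel E => `|rkhs_feature H y - simple N h B y|) ->
  (`|cond_expectation p (rkhs_eval H f) x -
      \sum_(i < N) rkhs_inner H f (h i) * fine (p x (B i))|%:E <=
   `|f|%:E * \int[p x]_y `|rkhs_feature H y - simple N h B y|%:E)%E.
Proof.
move=> mB mr.
have pT : (p x [set: borel E] < +oo)%E by rewrite prob_kernel ltry.
have [M fM] := C0_bounded (H_sub_C0 (imageT _ f)).
have if_ := bounded_integrable pT (measurable_rkhs_eval f) fM.
have is_ := integrable_simple pT N (fun i => rkhs_inner H f (h i)) mB.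
rewrite /cond_expectation.
rewrite -(Rintegral_simple pT N (fun i => rkhs_inner H f (h i)) mB).
rewrite -RintegralB//.
have iB : (p x).-integrable [set: borel E] (EFin \o (fun y => rkhs_eval H f y -
    \sum_(i < N) rkhs_inner H f (h i) * \1_(B i) y)).
  exact: (integrableB measurableT if_ is_).
rewrite EFin_normr_Rintegral//.
apply: le_trans (le_abse_integral (p x) measurableT (measurable_int _ iB)) _.
rewrite -ge0_integralZl//; last exact/measurable_EFinP.
apply: ge0_le_integral => //.
- by apply: measurableT_comp => //; exact: measurable_int iB.
- by apply: measurable_funeM; exact/measurable_EFinP.
move=> y _; rewrite /= rkhs_eval_sub_simple -EFinM lee_fin.
exact: rkhs_CauchySchwarz.
Qed.

Context (pi : probability (borel E) R) (nu : {measure set (borel E) -> \bar R}).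
Hypothesis nuE : forall B, measurable B -> nu B = (\int[pi]_x p x B)%E.

(** The error [A f - P f] is split at [\sum_i <f, h i> p(., B i)]: the first
    part comes from replacing each [p(., B i)] by [g i], the second from
    replacing the feature map by the simple function. *)
Lemma opnorm_sub_finite_rank_op_le N (h g : nat -> H)
    (B : nat -> set (borel E)) :
  (forall i, measurable (B i)) ->
  measurable_fun [set: borel E]
    (fun y : borel E => `|rkhs_feature H y - simple N h B y|) ->
  (opnorm_sub pi p
     (finite_rank_op (fun i : 'I_N => h i) (fun i : 'I_N => g i)) <=
   \sum_(i < N) `|h i|%:E *
      'N[pi]_2[EFin \o (rkhs_eval H (g i) \- fun x => fine (p x (B i)))%R] +
   'N[nu]_2[EFin \o (fun y => `|rkhs_feature H y - simple N h B y|)%R])%E.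
Proof.
move=> mB mr; apply: ub_ereal_sup => _ [f /= f1 <-].
set r := (fun y => _) in mr *.
pose v i : borel E -> R := rkhs_eval H (g i) \- fun x => fine (p x (B i)).
pose w : borel E -> R := fun x =>
  \sum_(i < N) rkhs_inner H f (h i) * fine (p x (B i)) -
  cond_expectation p (rkhs_eval H f) x.
have mv i : measurable_fun setT (v i).
  apply: measurable_funB; first exact: measurable_rkhs_eval.
  exact: measurable_fine_kernel.
have mw : measurable_fun setT w.
  apply: measurable_funB; last first.
    by apply: measurable_cond_expectation; exact: measurable_rkhs_eval.
  apply: measurable_sum => i; apply: measurable_funM => //.
  exact: measurable_fine_kernel.
have mfv : measurable_fun [set: borel E]
    (fun x => \sum_(i < N) rkhs_inner H f (h i) * v i x).
  by apply: measurable_sum => i; apply: measurable_funM.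
rewrite (@eq_Lnorm _ _ _ _ _ _ (EFin \o
  ((fun x => \sum_(i < N) rkhs_inner H f (h i) * v i x) \+ w)%R)); last first.
  move=> x; rewrite /= rkhs_eval_finite_rank_op /v /w /=; congr (_%:E).
  by under [in RHS]eq_bigr do rewrite mulrBr; rewrite sumrB subrKA.
have le12 : (1 <= 2 :> R)%R by rewrite ler1n.
apply: le_trans (minkowski_EFin pi mfv mw le12) _.
apply: leeD.
  apply: le_trans (Lnorm_sum_le pi N (fun i => rkhs_inner H f (h i)) le12 mv) _.
  apply: lee_sum => i _; apply: lee_wpmul2r; first exact: Lnorm_ge0.
  rewrite lee_fin (le_trans (rkhs_CauchySchwarz _ _))//.
  by rewrite ler_piMl.
have r0 y : (0 <= r y)%R by exact: normr_ge0.
apply: le_trans (Lnorm2_kernel_integral_le nuE mr r0).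
apply: le_Lnorm => //.
- exact/measurable_EFinP.
- apply: measurable_fun_integral_kernel => //; first exact: measurable_kernel.
  exact/measurable_EFinP.
move=> x.
have int_ge0 : (0 <= \int[p x]_y (r y)%:E)%E.
  by apply: integral_ge0 => y _; rewrite lee_fin.
rewrite [leRHS]gee0_abs//.
rewrite /= distrC (le_trans (cond_expectation_sub_simple_le f x mB mr))//.
by rewrite -[leRHS]mul1e lee_wpmul2r ?lee_fin.
Qed.

End main_estimate.

Lemma exists_finite_rank_op_le (R : realType) (E : ptopologicalType)
    (k : E -> E -> R) (H : rkhs k) (p : R.-pker (borel E) ~> (borel E))
    (pi : probability (borel E) R) (nu : {measure set (borel E) -> \bar R})
    (e : R) :
  separable_space H ->
  measurable_fun [set: borel E] (rkhs_feature H : borel E -> borel H) ->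
  range (rkhs_eval H) `<=` @C0 R E ->
  dense_in_L2 pi (range (rkhs_eval H)) ->
  (forall B, measurable B -> nu B = (\int[pi]_x p x B)%E) ->
  (\int[nu]_y (`|rkhs_feature H y| ^+ 2)%:E < +oo)%E ->
  0 < e ->
  exists2 A : {linear H -> H}, finite_rank A & (opnorm_sub pi p A <= e%:E)%E.
Proof.
move=> /separable_dense_seq[h h_dense] mphi HC0 H_dense nuE phi2 e0.
have e20 : 0 < e / 2 by rewrite divr_gt0.
have [N [B [mB mr r_small]]] := bochner_simple_approx mphi h_dense e20 phi2.
(* With this tolerance [|h i| * delta i] is at most [e / 2 / N.+1], and there
   are [N] such terms; adding 1 to [|h i|] avoids dividing by 0. *)
pose delta i := e / 2 / N.+1%:R / (`|h i| + 1).
have hp i : 0 < `|h i| + 1 by rewrite ltr_wpDl.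
have delta0 i : 0 < delta i by rewrite !divr_gt0.
have /choice[g gP] i : exists g : H,
    ('N[pi]_2[EFin \o (rkhs_eval H g \- fun x => fine (p x (B i)))%R]
      < (delta i)%:E)%E.
  have [_ [g _ <-] gi] := H_dense _ (kernel_Lfun2 pi p (mB i)) _ (delta0 i).
  by exists g.
exists (finite_rank_op (fun i : 'I_N => h i) (fun i : 'I_N => g i)).
  exact: finite_rank_opP.
apply: le_trans (opnorm_sub_finite_rank_op_le HC0 nuE g mB mr) _.
have -> : e%:E = ((e / 2)%:E + (e / 2)%:E)%E by rewrite -EFinD -splitr.
apply: leeD; last exact: ltW.
apply: (@le_trans _ _ (\sum_(i < N) (e / 2 / N.+1%:R)%:E)%E).
  apply: lee_sum => i _.
  apply: (@le_trans _ _ (`|h i|%:E * (delta i)%:E)%E).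
    by rewrite lee_wpmul2l ?lee_fin// ltW.
  rewrite -EFinM lee_fin /delta mulrCA ler_piMr ?divr_ge0 ?(ltW e0)//.
  by rewrite ler_pdivrMr// mul1r lerDl.
rewrite sumEFin lee_fin sumr_const card_ord -mulrnAr ler_piMr ?(ltW e20)//.
by rewrite -mulr_natl ler_pdivrMr// mul1r ler_nat.
Qed.

Theorem corollary3p5 (R : realType) (E : ptopologicalType)
    (E_second_countable : @second_countable E)
    (E_locally_compact : locally_compact [set: E])
    (E_hausdorff : hausdorff_space E)
    (d : measure_display) (Omega : measurableType d) (P : probability Omega R)
    (X Y : {RV P >-> borel E})
    (p : R.-pker (borel E) ~> (borel E))
    (p_cond : regular_cond_distribution X Y p)
    (k : E -> E -> R) (H : rkhs k)
    (H_separable : separable_space H)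
    (phi_measurable : measurable_fun [set: borel E]
      (rkhs_feature H : borel E -> borel H))
    (phiX_L2 : ('E_P[(fun w => `|rkhs_feature H (X w)| ^+ 2)%R] < +oo)%E)
    (phiY_L2 : ('E_P[(fun w => `|rkhs_feature H (Y w)| ^+ 2)%R] < +oo)%E)
    (H_sub_C0 : range (rkhs_eval H) `<=` @C0 R E)
    (H_dense : dense_in_L2 (distribution P X) (range (rkhs_eval H))) :
  exists A : nat -> {linear H -> H},
    (forall n, finite_rank (A n)) /\
    opnorm_sub (distribution P X) p (A n) @[n --> \oo] --> 0%E.
Proof.
have phi2 : (\int[distribution P Y]_y (`|rkhs_feature H y| ^+ 2)%:E < +oo)%E.
  rewrite ge0_integral_distribution//.
  - by move: phiY_L2; rewrite unlock.
  - apply/measurable_EFinP; apply: measurable_funX.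
    by have := measurable_normB phi_measurable 0; under eq_fun do rewrite subr0.
have /choice[A AP] (n : nat) : exists A : {linear H -> H},
    finite_rank A /\ (opnorm_sub (distribution P X) p A <= (n.+1%:R^-1)%:E)%E.
  have n0 : 0 < n.+1%:R^-1 :> R by rewrite invr_gt0.
  have [A Afin An] := exists_finite_rank_op_le H_separable phi_measurable
    H_sub_C0 H_dense (regular_cond_distribution_marginal p_cond) phi2 n0.
  by exists A.
exists A; split=> [n|]; first exact: (AP n).1.
apply: (@squeeze_cvge _ _ _ _ (cst 0%E) _ (fun n => (n.+1%:R^-1)%:E)).
- apply: nearW => n; rewrite (AP n).2 andbT /opnorm_sub.
  apply: ereal_sup_ge; eexists.
    by exists (0 : H) => //=; rewrite normr0.
  exact: Lnorm_ge0.
- exact: cvg_cst.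
- apply: cvg_EFin; first exact: nearW.
  exact: cvg_harmonic.
Qed.
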